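(* Let $\mathcal R$ be a noncommutative ring with identity, let $n$ and $s_1,\dots,s_n$ be positive integers, and let $m=\sum_{j=1}^n s_j$. Let $M\in\mathcal R^{m\times m}$ be a block upper triangular matrix $$M=\begin{bmatrix} M_{11} & \cdots & M_{1n}\\ & \ddots & \vdots\\ & & M_{nn}\end{bmatrix},$$ where $M_{jk}\in\mathcal R^{s_j\times s_k}$ for $1\le j\le k\le n$, all blocks $M_{jk}$ with $j>k$ are zero, and each diagonal block $M_{kk}$ is invertible in the ring $\mathcal R^{s_k\times s_k}$ (so that $M$ is invertible in $\mathcal R^{m\times m}$). Write $M^{-1}=(M^{[-]}_{jk})_{j,k=1}^n$ with $M^{[-]}_{jk}\in\mathcal R^{s_j\times s_k}$. Then for all $j,k\in\{1,\dots,n\}$ with $j\le k$ and for any $l=1,\dots,k-j$, $$M^{[-]}_{jk}=-\sum_{p=0}^{l-1}\sum_{q=l}^{k-j} M^{[-]}_{j,p+j}\,M_{j+p,j+q}\,M^{[-]}_{j+q,k},$$ or equivalently, in matrix form, $$M^{[-]}_{jk}=-\left[M^{[-]}_{jj},\cdots,M^{[-]}_{j,j+l-1}\right]\cdot M^{(j,j+l)}_{[l,k-j-l+1]}\cdot\begin{bmatrix} M^{[-]}_{j+l,k}\\ \vdots\\ M^{[-]}_{kk}\end{bmatrix},$$ where $M^{(j,j+l)}_{[l,k-j-l+1]}$ is the block submatrix of $M$ formed by block rows $j,\dots,j+l-1$ and block columns $j+l,\dots,k$.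
   Context: $\mathcal R^{p\times q}$ denotes the set of $p\times q$ matrices over $\mathcal R$. For a block matrix $M=[M_{jk}]_{j,k=1}^n$, $M^{(v,w)}_{[a,b]}$ denotes the block submatrix with block rows $v,\dots,v+a-1$ and block columns $w,\dots,w+b-1$. *)

(* Defs.v *)
From HB Require Import structures.
From mathcomp Require Import all_boot all_order all_algebra.

Set Implicit Arguments.
Unset Strict Implicit.
Unset Printing Implicit Defensive.

Import GRing.Theory.
Local Open Scope ring_scope.

(* unitmx and invmx require a commutative coefficient ring. Over a
   noncommutative one a one-sided inverse need not be two-sided, so both
   equations are demanded. *)
Definition mx_inverse (R : pzRingType) (m : nat) (A B : 'M[R]_m) : Prop :=
  A *m B = 1%:M /\ B *m A = 1%:M.

Definition mx_invertible (R : pzRingType) (m : nat) (A : 'M[R]_m) : Prop :=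
  exists B : 'M[R]_m, mx_inverse A B.

(* Block indices start at 0, so that the last block index is n; the value of
   inord i is i only for i <= n, and blocksub is meaningful only when
   v + a <= n.+1 and w + b <= n.+1. *)
Section Blocks.
Variables (R : pzRingType) (n : nat) (s : 'I_n.+1 -> nat).
Implicit Type M : 'M[R]_(\sum_i s i).

Definition block_upper_triangular M : Prop :=
  forall j k : 'I_n.+1, (k < j)%N -> submxblock M j k = 0.

(* Block rows v, ..., v + a - 1 and block columns w, ..., w + b - 1 of M. *)
Definition blocksub M (v w a b : nat) :
    'M[R]_(\sum_(p < a) s (inord (v + p)), \sum_(q < b) s (inord (w + q))) :=
  \mxblock_(p < a, q < b) submxblock M (inord (v + p)) (inord (w + q)).

End Blocks.

(* Main.v *)
Require Import Defs.
From HB Require Import structures.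
From mathcomp Require Import all_boot all_order all_algebra.

Set Implicit Arguments.
Unset Strict Implicit.
Unset Printing Implicit Defensive.

Import GRing.Theory.
Local Open Scope ring_scope.

(** Let X be the inverse of M. Two facts about block upper triangular matrices
    give everything.

    First, M has an inverse which is again block upper triangular
    ([triangular_inverse]). Scaling the block rows of M by the inverses of the
    diagonal blocks leaves 1 - U with U strictly block upper triangular, hence
    nilpotent, and the geometric series in U inverts 1 - U on both sides. Its
    terms are block upper triangular, and the inverse is unique, so X itself is
    block upper triangular.

    Second, cut the block indices at c with j < c <= k ([inverse_block_cut]),
    and sum X_jp M_pq X_qk over j <= p < c. For a fixed p < c the sum over all q
    is X_jp times the (p, k) block of M X = 1, which is 0 because p < c <= k;
    since X_qk = 0 for q > k, summing over c <= q <= k is, up to sign, summing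
    over q < c. For a fixed
    q < c, triangularity of X and M removes every p outside [j, c), so the sum
    over p is the (j, q) block of X M = 1 times X_qk. Only q = j survives, and
    the total is - X_jk. The case c = j + l is the theorem; its two displayed
    forms differ by the order of summation. *)

(** The geometric sum commutes with u, so the right inverse that telescoping
    provides is also a left inverse. *)
Lemma nilpotent_geometric (A : pzRingType) (u : A) (d : nat) : u ^+ d = 0 ->
  (1 - u) * (\sum_(i < d) u ^+ i) = 1 /\ (\sum_(i < d) u ^+ i) * (1 - u) = 1.
Proof.
move=> ud0; have inv_r : (1 - u) * (\sum_(i < d) u ^+ i) = 1.
  by rewrite -opprB mulNr -subrX1 ud0 sub0r opprK.
split=> //; rewrite -[RHS]inv_r; apply/esym/commr_sum => i _.
by apply/commr_sym/commrB; [apply: commr1 | apply/commr_sym/commrX].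
Qed.

Lemma mx_inverse_unique (R : pzRingType) m (A X Y : 'M[R]_m) :
  mx_inverse A X -> mx_inverse A Y -> X = Y.
Proof.
by move=> [_ XA] [AY _]; rewrite -[X]mulmx1 -AY mulmxA XA mul1mx.
Qed.

Section BlockTriangular.
Variables (R : pzRingType) (n : nat) (s : 'I_n.+1 -> nat).
Implicit Types M N X : 'M[R]_(\sum_i s i).

Lemma submxblock_mul M N j k :
  submxblock (M *m N) j k = \sum_i submxblock M j i *m submxblock N i k.
Proof.
by rewrite -{1}[M]submxblockK -{1}[N]submxblockK mul_mxblock mxblockK.
Qed.

Lemma submxblock1_neq j k :
  j != k -> submxblock (1%:M : 'M[R]_(\sum_i s i)) j k = 0.
Proof.
by move=> /negPf jk; rewrite -mxdiagZ /mxdiag mxblockK /= jk.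
Qed.

Lemma submxblock1_diag j :
  submxblock (1%:M : 'M[R]_(\sum_i s i)) j j = 1%:M.
Proof. by rewrite -mxdiagZ submxblock_diag. Qed.

(** Vanishing below the d-th block superdiagonal: d = 0 is block upper
    triangular, d = 1 strictly so. These form a multiplicative filtration, which
    yields at once that triangular matrices are closed under product and that
    strictly triangular ones are nilpotent. *)
Definition upper_level (d : nat) M : Prop :=
  forall j k : 'I_n.+1, (k < j + d)%N -> submxblock M j k = 0.

Lemma upper_level0 M : block_upper_triangular M <-> upper_level 0 M.
Proof. by split=> U j k; have := U j k; rewrite addn0. Qed.

(** A nonzero term at the intermediate index i needs both j + d <= i and
    i + e <= k. *)
Lemma upper_level_mul d e M N :
  upper_level d M -> upper_level e N -> upper_level (d + e) (M *m N).
Proof.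
move=> UM UN j k lt_k; rewrite submxblock_mul big1 // => i _.
have [lt_i | le_i] := ltnP i (j + d); first by rewrite UM ?mul0mx.
by rewrite UN ?mulmx0 // (leq_trans lt_k) // addnA leq_add2r.
Qed.

Lemma upper_level_exp M d : upper_level 1 M -> upper_level d (M ^+ d).
Proof.
move=> UM; elim: d => [|d IHd].
  move=> j k; rewrite addn0 expr0 => lt_kj.
  by rewrite submxblock1_neq // -val_eqE gtn_eqF.
by rewrite exprS -add1n; apply: upper_level_mul.
Qed.

Lemma upper_level_nilpotent M : upper_level 1 M -> M ^+ n.+1 = 0.
Proof.
move=> /(@upper_level_exp _ n.+1) UM; apply/mxblockP => j k.
by rewrite submxblock0 UM // ltn_addl.
Qed.

(** With D the block diagonal of M and E its inverse, E M = 1 - U for a strictly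
    triangular U; if V is the geometric sum of U, then V E inverts M. That V E is
    a right inverse also uses D E = 1: E M V = 1 only says that M V = D. *)
Lemma triangular_inverse M :
    block_upper_triangular M ->
    (forall k, mx_invertible (submxblock M k k)) ->
  exists2 X, mx_inverse M X & block_upper_triangular X.
Proof.
move=> UM /fin_all_exists [B invB].
pose D := \mxdiag_i submxblock M i i; pose E := \mxdiag_i B i.
have DE : D *m E = 1%:M.
  rewrite -mxdiagZ /E mul_mxdiag_mxblock; apply: eq_mxblock => i j.
  case: eqVneq => [<-|_]; last by rewrite mulmx0.
  by rewrite !conform_mx_id (invB i).1.
pose U : 'M[R]_(\sum_i s i) := 1%:M - E *m M.
have blockE j k : submxblock (E *m M) j k = B j *m submxblock M j k.
  by rewrite -{1}[M]submxblockK mul_mxdiag_mxblock mxblockK.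
have levelU : upper_level 1 U.
  move=> j k; rewrite addn1 ltnS leq_eqVlt submxblockB blockE.
  case/predU1P => [/val_inj-> | lt_kj].
    by rewrite submxblock1_diag (invB j).2 subrr.
  by rewrite submxblock1_neq -?val_eqE ?gtn_eqF // UM // mulmx0 subr0.
have levelE : upper_level 0 E.
  move=> j k; rewrite addn0 => lt_kj.
  by rewrite mxblockK; case: eqVneq lt_kj => // ->; rewrite ltnn.
pose V : 'M[R]_(\sum_i s i) := \sum_(i < n.+1) U ^+ i.
have [] := nilpotent_geometric (upper_level_nilpotent levelU).
rewrite -/V subKr => EMV VEM.
exists (V *m E).
  split; last by rewrite -mulmxA.
  rewrite -[LHS]mul1mx -DE -!mulmxA; congr (D *m _).
  by rewrite !mulmxA -[E *m M *m V]/((E *m M) * V) EMV mul1mx.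
apply/upper_level0; apply: (@upper_level_mul 0 0) => //.
move=> j k lt_kj; rewrite submxblock_sum big1 // => i _.
by apply: (upper_level_exp levelU); rewrite ltn_addr // -[X in (_ < X)%N]addn0.
Qed.

(** The identity behind the theorem, indexed by absolute block positions and by
    the cut c = j + l rather than by offsets from j. *)
Lemma inverse_block_cut M X (j k : 'I_n.+1) (c : nat) :
    block_upper_triangular M -> block_upper_triangular X -> mx_inverse M X ->
    (j < c <= k)%N ->
  submxblock X j k =
    - \sum_(p : 'I_n.+1 | (j <= p < c)%N) \sum_(q : 'I_n.+1 | (c <= q < k.+1)%N)
        submxblock X j p *m submxblock M p q *m submxblock X q k.
Proof.
move=> UM UX [MX XM] /andP[lt_jc le_ck].
(* Row p of M X = 1 has zero block in column k, since p < c <= k. *)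
have cut_q (p : 'I_n.+1) : (j <= p < c)%N ->
    \sum_(q : 'I_n.+1 | (c <= q < k.+1)%N)
        submxblock X j p *m submxblock M p q *m submxblock X q k =
    - \sum_(q : 'I_n.+1 | (q < c)%N)
        submxblock X j p *m submxblock M p q *m submxblock X q k.
  case/andP=> _ lt_pc; apply/eqP; rewrite -addr_eq0 addrC; apply/eqP.
  transitivity (\sum_q submxblock X j p *m submxblock M p q *m submxblock X q k).
    rewrite [RHS](bigID (fun q : 'I_n.+1 => (q < c)%N)) /=; congr (_ + _).
    rewrite [RHS](bigID (fun q : 'I_n.+1 => (q < k.+1)%N)) /=.
    rewrite [X in _ = _ + X]big1 ?addr0 => [|q /andP[_]].
      by apply: eq_bigl => q; rewrite leqNgt.
    by rewrite -leqNgt => lt_kq; rewrite (UX q k) // mulmx0.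
  under eq_bigr do rewrite -mulmxA.
  rewrite -mulmx_sumr -submxblock_mul MX submxblock1_neq ?mulmx0 //.
  by rewrite -val_eqE ltn_eqF // (leq_trans lt_pc).
rewrite (eq_bigr _ cut_q) sumrN opprK exchange_big /=.
(* Triangularity lets p range over all blocks, which produces X M = 1. *)
have cut_p (q : 'I_n.+1) : (q < c)%N ->
    \sum_(p : 'I_n.+1 | (j <= p < c)%N)
        submxblock X j p *m submxblock M p q *m submxblock X q k =
    submxblock (1%:M : 'M[R]_(\sum_i s i)) j q *m submxblock X q k.
  move=> lt_qc; rewrite -XM submxblock_mul -mulmx_suml; congr (_ *m _).
  rewrite [RHS](bigID (fun p : 'I_n.+1 => (j <= p < c)%N)) /=.
  rewrite [X in _ = _ + X]big1 ?addr0 // => p.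
  rewrite negb_and -ltnNge -leqNgt => /orP[lt_pj | le_cp].
    by rewrite UX ?mul0mx.
  by rewrite UM ?mulmx0 // (leq_trans lt_qc).
rewrite (eq_bigr _ cut_p) (bigD1 j) //= submxblock1_diag mul1mx big1 ?addr0 //.
by move=> q /andP[_ neq_qj]; rewrite submxblock1_neq ?mul0mx // eq_sym.
Qed.

End BlockTriangular.

(** Passes from offsets to block positions; the bound on j + v keeps every
    offset in the range where [inord] is faithful. *)
Lemma sum_inord_shift (V : nmodType) (n j u v : nat) (F : 'I_n.+1 -> V) :
  (j + v <= n.+1)%N ->
  \sum_(u <= p < v) F (inord (j + p)) =
  \sum_(p : 'I_n.+1 | (j + u <= p < j + v)%N) F p.
Proof.
move=> le_n; transitivity (\sum_(j + u <= p < j + v) F (inord p)).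
  rewrite -[(j + u)%N]addnC big_addn addKn.
  by apply: eq_bigr => p _; rewrite addnC.
rewrite (big_nat_widen _ _ _ _ _ le_n) (big_nat_widenl _ 0) // big_mkord.
by apply: eq_big => [p | p _]; rewrite ?inord_val // andbC.
Qed.

Theorem theorem3p2 (R : pzRingType) (n : nat) (s : 'I_n.+1 -> nat)
    (s_gt0 : forall i : 'I_n.+1, (0 < s i)%N)
    (M : 'M[R]_(\sum_i s i))
    (M_upper : block_upper_triangular M)
    (M_diag : forall k : 'I_n.+1, mx_invertible (submxblock M k k)) :
  mx_invertible M /\
  forall Minv : 'M[R]_(\sum_i s i), mx_inverse M Minv ->
  forall (j k : 'I_n.+1) (l : nat), (j <= k)%N -> (1 <= l <= k - j)%N ->
    submxblock Minv j k =
      - (\sum_(0 <= p < l) \sum_(l <= q < (k - j).+1)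
           submxblock Minv j (inord (j + p))
           *m submxblock M (inord (j + p)) (inord (j + q))
           *m submxblock Minv (inord (j + q)) k)
    /\
    submxblock Minv j k =
      - ((\mxrow_(p < l) submxblock Minv j (inord (j + p)))
         *m blocksub M j (j + l) l (k - j - l + 1)
         *m (\mxcol_(q < k - j - l + 1)
               submxblock Minv (inord (j + l + q)) k)).
Proof.
have [X invX UX] := triangular_inverse M_upper M_diag.
split=> [|Minv invM j k l le_jk /andP[l_gt0 le_l]]; first by exists X.
rewrite (mx_inverse_unique invM invX) {Minv invM}.
have le_jlk : (j + l <= k)%N by rewrite -leq_subRL // subnKC.
(* The three block shapes depend on p and q, but their product does not; this
   is what allows reindexing the sums of G. *)
pose G p q := submxblock X j p *m submxblock M p q *m submxblock X q k.
have sum_q (p : 'I_n.+1) :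
    \sum_(l <= q < (k - j).+1) G p (inord (j + q)) =
    \sum_(q : 'I_n.+1 | (j + l <= q < k.+1)%N) G p q.
  have jk : (j + (k - j).+1 = k.+1)%N by rewrite addnS subnKC.
  by rewrite sum_inord_shift jk // ltnS ltn_ord.
have entrywise : submxblock X j k = - \sum_(0 <= p < l)
    \sum_(l <= q < (k - j).+1) G (inord (j + p)) (inord (j + q)).
  have le_jl : (j + l <= n.+1)%N by rewrite (leq_trans le_jlk) // ltnW.
  rewrite (eq_bigr _ (fun p _ => sum_q (inord (j + p)))).
  rewrite (sum_inord_shift 0 (fun p => \sum_(q | _) G p q) le_jl) addn0.
  apply: inverse_block_cut => //.
  by rewrite le_jlk -addn1 leq_add2l l_gt0.
split=> //; rewrite entrywise; congr (- _).
rewrite mul_mxrow_mxblock mul_mxrow_mxcol exchange_big /=.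
rewrite -[l in X in X = _]add0n big_addn.
have -> : ((k - j).+1 - l = k - j - l + 1)%N by rewrite addn1 subSn.
rewrite big_mkord; apply: eq_bigr => q _.
rewrite mulmx_suml big_mkord; apply: eq_bigr => p _.
by rewrite /G addnAC addnA.
Qed.
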